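(* Assume $\kappa > \aleph_0$ is a measurable cardinal and $\kappa < \lambda$. Then there is $\mathcal{D}$ such that: (1) $\mathcal{D}$ is a regular ultrafilter on $\lambda$; (2) $\mathcal{D}$ is flexible, i.e. $\lambda$-flexible; (3) $\mathcal{D}$ is not $\kappa^{++}$-good.
   Context: Let $\mathcal{D}$ be a filter on $\lambda$. $\mathcal{D}$ is regular if there is a family $\langle X_i : i < \lambda\rangle$ of members of $\mathcal{D}$ such that each $t \in \lambda$ lies in only finitely many $X_i$. $\mathcal{D}$ is $\lambda$-flexible if for every $f : \lambda \to \mathbb{N}$ such that $\{t : n < f(t)\} \in \mathcal{D}$ for all $n \in \mathbb{N}$, there are $X_\alpha \in \mathcal{D}$ for $\alpha < \lambda$ with $f(t) \geq |\{\alpha < \lambda : t \in X_\alpha\}|$ for all $t \in \lambda$. $\mathcal{D}$ is $\mu^+$-good if every $f : [\mu]^{<\aleph_0} \to \mathcal{D}$ has a multiplicative refinement, i.e. there is $f' : [\mu]^{<\aleph_0} \to \mathcal{D}$ with $f'(u) \subseteq f(u)$ and $f'(u) \cap f'(v) = f'(u \cup v)$ for all $u, v \in [\mu]^{<\aleph_0}$. (So ''$\kappa^{++}$-good'' is this property with $\mu = \kappa^+$.) *)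

(* Defs.v *)
From mathcomp Require Import all_boot.
From mathcomp Require Import boolp classical_sets functions cardinality filter.

Set Implicit Arguments.
Unset Strict Implicit.
Unset Printing Implicit Defensive.

Local Open Scope classical_set_scope.
Local Open Scope card_scope.

(* An infinite cardinal is represented by an arbitrary type of that
   cardinality: none of the notions below depends on more than the
   cardinalities of the types involved. *)

Definition card_lt (T U : Type) (A : set T) (B : set U) : Prop :=
  (A #<= B) /\ ~ (B #<= A).

(* M has the cardinality of the successor cardinal of K *)
Definition card_succ (K M : Type) : Prop :=
  card_lt [set: K] [set: M] /\
  forall N : Type, card_lt [set: K] [set: N] -> [set: M] #<= [set: N].

(* Families of fewer than |K| sets are indexed by the subsets J of K with
   |J| < |K|; every cardinal below |K| is the cardinality of such a J. *)
Definition card_complete (K : Type) (U : set_system K) : Prop :=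
  forall (J : set K) (F : K -> set K), card_lt J [set: K] ->
    (forall i, J i -> U (F i)) -> U (\bigcap_(i in J) F i).

Definition measurable_cardinal (K : Type) : Prop :=
  card_lt [set: nat] [set: K] /\
  exists U : set_system K,
    [/\ UltraFilter U, forall x, ~ U [set x] & card_complete U].

Definition regular_filter (L : Type) (D : set_system L) : Prop :=
  exists X : L -> set L,
    (forall i, D (X i)) /\ (forall t, finite_set [set i | X i t]).

(* [A #<= `I_n] says that A is finite with at most n elements. *)
Definition flexible (L : Type) (D : set_system L) : Prop :=
  forall f : L -> nat, (forall n, D [set t | (n < f t)%N]) ->
    exists X : L -> set L,
      (forall a, D (X a)) /\ (forall t, [set a | X a t] #<= `I_(f t)).

(* Functions on the finite subsets of M are total functions on [set M] of
   which only the values at finite sets matter. *)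
Definition multiplicative_refinement (M L : Type) (D : set_system L)
    (f g : set M -> set L) : Prop :=
  [/\ forall u, finite_set u -> D (g u),
      forall u, finite_set u -> g u `<=` f u
    & forall u v, finite_set u -> finite_set v -> g u `&` g v = g (u `|` v)].

(* "D is mu^+-good", for M of cardinality mu *)
Definition succ_good (M L : Type) (D : set_system L) : Prop :=
  forall f : set M -> set L, (forall u, finite_set u -> D (f u)) ->
    exists g : set M -> set L, multiplicative_refinement D f g.

(* Main.v *)
From Stdlib Require Inverse_Image.
Require Import Defs.
From mathcomp Require Import all_boot.
From mathcomp Require Import boolp classical_sets functions cardinality filter.
From mathcomp Require Import wochoice.

(** Let E be a nonprincipal kappa-complete ultrafilter on K and U a regular
    flexible ultrafilter on L.  The ultrafilter D consists of the sets A of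
    pairs such that, for E-almost all i, the fibre A_i is in U; it is moved
    to L along an injection of K * L into L.

    Regularity of D is that of U.  As E is countably complete, an f which is
    nonstandard modulo D has U-nonstandard fibres f_i for E-almost all i, so
    flexibility can be checked fibrewise.

    For the failure of goodness, diagonalization gives kappa^+ functions
    h_a : K -> K which are pairwise distinct E-almost everywhere.  A
    multiplicative refinement of u |-> {(i, t) | the h_a i, a in u, are
    distinct} would provide sets A_a in D, and an index i_a with the fibre of
    A_a at i_a in U.  When i_a = i_b = i the fibres of A_a and A_b at i meet,
    so h_a i <> h_b i; hence a |-> (i_a, h_a i_a) would inject kappa^+ into
    K * K.

    The ultrafilter U is Kunen's construction with an independent family of
    functions G g : L -> seq L, for g : L -> nat.  A recursion of length
    2^lambda over f : L -> nat enlarges a filter, using up finitely many of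
    the G g at each step: either some {f <= n} is added, so that f is standard
    for good, or all the {f > n} can be added, and then so can the sets
    {t | a \in G c t, size (G c t) <= f t} for a fresh c. *)

Local Open Scope classical_set_scope.
Local Open Scope card_scope.

(** * Cardinalities of types *)

Definition embeds (A B : Type) := exists f : A -> B, injective f.

Lemma embeds_trans {A} B {C} : embeds A B -> embeds B C -> embeds A C.
Proof. by case=> f fI [g gI]; exists (g \o f); exact: inj_comp. Qed.

Lemma embeds_prod {A B A' B'} :
  embeds A B -> embeds A' B' -> embeds (A * A') (B * B').
Proof.
case=> f fI [g gI]; exists (fun x => (f x.1, g x.2)).
by move=> [x y] [x' y'] /= [/fI -> /gI ->].
Qed.

Lemma embeds_seq {A B} : embeds A B -> embeds (seq A) (seq B).
Proof. by case=> f fI; exists (map f); exact: inj_map. Qed.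

Lemma embeds_cancel {A B} (a : A) :
  embeds A B -> exists (f : A -> B) (g : B -> A), cancel f g.
Proof.
case=> f fI; exists f.
exists (fun b => if pselect (exists a, f a = b) is left h
                 then projT1 (cid h) else a).
move=> x; case: pselect => [h|[]]; last by exists x.
exact/fI/(projT2 (cid h)).
Qed.

Lemma embeds_surj {A B} (f : A -> B) :
  (forall b, exists a, f a = b) -> embeds B A.
Proof.
move=> h; exists (fun b => projT1 (cid (h b))) => b b' e.
by rewrite -(projT2 (cid (h b))) e (projT2 (cid (h b'))).
Qed.

Lemma sval_inj {T} (P : T -> Prop) : injective (fun x : {x | P x} => sval x).
Proof.
by move=> x y e; apply: eq_sig_hprop e => z p q; exact: Prop_irrelevance.
Qed.

Lemma embeds_sig {T} (P : T -> Prop) : embeds {x | P x} T.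
Proof. by exists (fun x => sval x); exact: sval_inj. Qed.

Lemma card_le_embeds {T U} (A : set T) (B : set U) :
  A #<= B <-> embeds {x | A x} {x | B x}.
Proof.
split.
- move=> /card_leP[f].
  exists (fun x => exist _ _
    (set_mem (valP (f (SigSub (mem_set (proj2_sig x))))))).
  move=> [x Ax] [y Ay] /= [] /val_inj /(@inj _ _ _ f).
  by move=> /(_ (mem_set I) (mem_set I)) [e]; exact: eq_exist.
- case=> f fI; have gP (x : A) : B (sval (f (exist _ _ (set_mem (valP x))))).
    exact: proj2_sig.
  apply/card_leP; suff: $|{inj [set: A] >-> (B : Type)}|.
    by case=> g; squash (totalfun_ [set: A] g).
  apply/injPex; exists (fun x => SigSub (mem_set (gP x))).
  move=> x y _ _ [] /eq_sig_hprop h.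
  have {h} /fI [e] : f (exist _ _ (set_mem (valP x))) =
    f (exist _ _ (set_mem (valP y))).
    by apply: h => z p q; exact: Prop_irrelevance.
  exact: val_inj.
Qed.

Lemma card_leT_embeds {T U} : [set: T] #<= [set: U] <-> embeds T U.
Proof.
rewrite card_le_embeds; split.
- case=> f fI; exists (fun x => sval (f (exist _ x I))) => x y h.
  suff /fI [] : f (exist _ x I) = f (exist _ y I) by [].
  by apply: eq_sig_hprop h => z p q; exact: Prop_irrelevance.
- case=> f fI; exists (fun x => exist _ (f (sval x)) I).
  by move=> [x []] [y []] /= [/fI ->].
Qed.

(* A maximal set S of elements of the product on which every projection is
   injective has a surjective projection, onto some A i; S is then the graph of
   embeddings of A i into all the A j. *)
Lemma embeds_min {J} (A : J -> Type) (j0 : J) :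
  exists i, forall j, embeds (A i) (A j).
Proof.
pose P (S : set (forall j, A j)) :=
  forall j x y, S x -> S y -> x j = y j -> x = y.
have [S [PS Smax]] : exists S, P S /\ forall S', S `<` S' -> ~ P S'.
  apply: Zorn_bigcup => F FP Ftot j x y [X FX Xx] [Y FY Yy].
  by case: (Ftot X Y FX FY) => XY; [apply: (FP _ FY)|apply: (FP _ FX)];
    rewrite //; exact: XY.
have [i hi] : exists i, forall a : A i, exists x, S x /\ x i = a.
  apply: contrapT => /forallNP h.
  have {}h i : {a : A i | forall x, S x -> x i <> a}.
    apply/cid; apply: contrapT => /forallNP h'; apply: (h i) => a.
    by apply: contrapT => /forallNP ha; apply: (h' a) => x Sx e; apply: (ha x).
  have z' j x : S x -> x j <> sval (h j) by case: (h j) => a /=; apply.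
  pose w j := sval (h j).
  apply: (Smax (S `|` [set w])).
    split; first by move=> x; left.
    by move=> /(_ w (or_intror erefl)) /(z' j0); apply.
  move=> j x y [Sx|->] [Sy|->] //; first exact: PS.
    by move=> /(z' j _ Sx).
  by move=> /esym /(z' j _ Sy).
exists i => j; exists (fun a => projT1 (cid (hi a)) j) => a b.
move: (projT2 (cid (hi a))) (projT2 (cid (hi b))) => [Sa ea] [Sb eb] e.
by rewrite -ea -eb (PS _ _ _ Sa Sb e).
Qed.

Lemma embeds_total A B : embeds A B \/ embeds B A.
Proof.
have [[] h] := @embeds_min bool (fun b => if b then A else B) true.
- by left; exact: (h false).
- by right; exact: (h true).
Qed.

(** Recursion with choice. A step must be solvable for arbitrary earlier values [h], so an invariant
    of the recursion can enter only as a premise inside [P]. *)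
Lemma well_founded_choice {T} {lt : T -> T -> Prop} {V : Type}
    (P : forall x, (forall y, lt y x -> V) -> V -> Prop) :
  well_founded lt -> (forall x h, exists v, P x h v) ->
  exists s : T -> V, forall x, P x (fun y _ => s y) (s x).
Proof.
move=> wf hP.
pose F x h := projT1 (cid (hP x h)).
exists (Fix wf _ F) => x; rewrite Fix_eq.
  by rewrite /F; case: cid.
move=> {}x h h' e; congr F.
apply: functional_extensionality_dep => y.
exact: functional_extensionality_dep.
Qed.

(* a well-order of T whose order type is a cardinal *)
Definition initial_order {T} (lt : T -> T -> Prop) :=
  [/\ well_founded lt, forall x y, [\/ lt x y, x = y | lt y x]
    & forall x, ~ embeds T {y | lt y x}].

(** Take the least [x] such that [T] embeds into the segment below [x], and pull the order back
    along the embedding; if there is no such [x], the given well-order will do. *)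
Lemma initial_order_exists T : exists lt : T -> T -> Prop, initial_order lt.
Proof.
have [R Rwo] := @well_ordering_principle {classic T}.
have anti : antisymmetric R.
  have wo : wo_chain R predT by move=> A _; exact: Rwo.
  by move=> x y; apply: (wo_chain_antisymmetric wo).
pose lt (x y : T) := ~~ R y x.
have ltT x y : [\/ lt x y, x = y | lt y x].
  case: (boolP (lt x y)) => [|/negPn yx]; first by constructor 1.
  case: (boolP (lt y x)) => [|/negPn xy]; first by constructor 3.
  by constructor 2; apply: anti; rewrite xy.
have ltWF : well_founded lt.
  move=> x; apply: contrapT => nx.
  have [|z [[]]] := Rwo (fun x => `[< ~ Acc lt x >]).
    by exists x; apply/asboolP.
  move=> /asboolP nz zmin _; apply: nz; constructor => y yz.
  apply: contrapT => ny; move/negP: yz; apply; apply: zmin.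
  exact/asboolP.
have [[x0 Tx0]|h] := pselect (exists x, embeds T {y | lt y x}); last first.
  by exists lt; split=> // x hx; apply: h; exists x.
have [x Tx xmin] : exists2 x, embeds T {y | lt y x} &
    forall y, lt y x -> ~ embeds T {z | lt z y}.
  move: Tx0; elim/(well_founded_ind ltWF): x0 => x IH Tx.
  have [[y [yx Ty]]|h] := pselect (exists y, lt y x /\ embeds T {z | lt z y}).
    exact: IH yx Ty.
  by exists x => // y yx Ty; apply: h; exists y.
have [f fI] := Tx; pose lt' a b := lt (sval (f a)) (sval (f b)).
have valI a b : sval (f a) = sval (f b) -> a = b.
  by move=> e; apply: fI; apply: eq_sig_hprop e => z p q; exact: Prop_irrelevance.
exists lt'; split.
- exact: Inverse_Image.wf_inverse_image (fun a => sval (f a)) ltWF.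
- by move=> a b; case: (ltT (sval (f a)) (sval (f b)));
    [constructor 1|move=> /valI; constructor 2|constructor 3].
- move=> a Ta; apply: (xmin _ (proj2_sig (f a))).
  apply: embeds_trans Ta _.
  exists (fun b : {b | lt' b a} =>
    exist (fun z => lt z (sval (f a))) (sval (f (sval b))) (proj2_sig b)).
  by move=> [b hb] [c hc] /= [] /valI e; subst c; exact: eq_exist.
Qed.

(* G is the graph of an injection of A * A into A; the set A is recovered from
   the diagonal of G. *)
Definition pairing_graph {T} (G : set (T * T * T)) :=
  let A := [set a | exists c, G (a, a, c)] in
  [/\ forall a b c, G (a, b, c) -> [/\ A a, A b & A c],
      forall a b, A a -> A b -> exists c, G (a, b, c),
      forall a b c a' b', G (a, b, c) -> G (a', b', c) -> a = a' /\ b = b'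
    & forall a b c c', G (a, b, c) -> G (a, b, c') -> c = c'].

(* Hessenberg's theorem.  Let A carry a maximal pairing phi.  If the complement
   of A embeds into A, then T embeds into A * {u, v}.  Otherwise j : A -> ~ A
   is injective and phi extends to C = A + j A, as C embeds into A * {u, v}
   and the new pairs can be sent to j A. *)
Lemma embeds_square T : embeds nat T -> embeds (T * T) T.
Proof.
case=> nu nuI.
pose G0 := [set x | exists m n, x = (nu m, nu n, nu (pickle (m, n)))].
have A0 a : (exists c, G0 (a, a, c)) -> exists n, a = nu n.
  by move=> [c [m [n [-> _ _]]]]; exists m.
have A0' n : exists c, G0 (nu n, nu n, c) by exists (nu (pickle (n, n))), n, n.
have pairG0 : pairing_graph G0.
  split.
  - by move=> a b c [m [n [-> -> ->]]]; split; exact: A0'.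
  - by move=> a b /A0[m ->] /A0[n ->]; exists (nu (pickle (m, n))), m, n.
  - move=> a b c a' b' [m [n [-> -> ->]]] [m' [n' [-> -> /nuI]]].
    by move=> /(pcan_inj pickleK) [-> ->].
  - by move=> a b c c' [m [n [-> -> ->]]] [m' [n' [/nuI <- /nuI <- ->]]].
pose P G := G = set0 \/ (G0 `<=` G /\ pairing_graph G).
have [G [PG Gmax]] : exists G, P G /\ forall G', G `<` G' -> ~ P G'.
  apply: Zorn_bigcup => F FP Ftot.
  have [[X FX X0]|h] := pselect (exists2 X, F X & X <> set0); last first.
    left; apply/seteqP; split=> // x [X FX Xx].
    by case: h; exists X => // X0; rewrite X0 in Xx.
  have XG0 : G0 `<=` X by case: (FP _ FX) => // -[].
  right; split; first by move=> x /XG0 Xx; exists X.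
  have good Y : F Y -> Y !=set0 -> pairing_graph Y.
    by move=> FY [y Yy]; case: (FP _ FY) => [Y0|[]//]; rewrite Y0 in Yy.
  have two x y : (\bigcup_(X in F) X) x -> (\bigcup_(X in F) X) y ->
      exists Y, [/\ F Y, pairing_graph Y, Y x & Y y].
    move=> [Y FY Yx] [Z FZ Zy]; case: (Ftot Y Z FY FZ) => YZ.
      by exists Z; split=> //; [apply: good => //; exists y|exact: YZ].
    by exists Y; split=> //; [apply: good => //; exists x|exact: YZ].
  split.
  - move=> a b c abc; have [Y [FY [gY _ _ _] /gY [Aa Ab Ac] _]] := two _ _ abc abc.
    by split; [move: Aa|move: Ab|move: Ac] => -[d Yd]; exists d, Y.
  - move=> a b [c aac] [d bbd]; have [Y [FY [_ gY _ _] Ya Yb]] := two _ _ aac bbd.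
    have [|| e Ye] := gY a b; [by exists c|by exists d|by exists e, Y].
  - move=> a b c a' b' h h'; have [Y [FY [_ _ gY _] Ya Yb]] := two _ _ h h'.
    exact: gY Ya Yb.
  - move=> a b c c' h h'; have [Y [FY [_ _ _ gY] Ya Yb]] := two _ _ h h'.
    exact: gY Ya Yb.
have {PG} [G0G [G1 G2 G3 G4]] : G0 `<=` G /\ pairing_graph G.
  case: PG => // G_0; exfalso; apply: (Gmax G0); last by right; split.
  rewrite G_0; split=> // /(_ (nu 0, nu 0, nu (pickle (0, 0)))); apply.
  by exists 0, 0.
pose A := [set a | exists c, G (a, a, c)].
pose phi a b := if pselect (exists c, G (a, b, c)) is left h
                then projT1 (cid h) else a.
have phiG a b : A a -> A b -> G (a, b, phi a b).
  move=> Aa Ab; rewrite /phi; case: pselect => [h|[]]; last exact: G2.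
  exact: projT2 (cid h).
have phiA a b : A a -> A b -> A (phi a b).
  by move=> Aa Ab; have [_ _] := G1 _ _ _ (phiG _ _ Aa Ab).
have phiI a b a' b' : A a -> A b -> A a' -> A b' -> phi a b = phi a' b' ->
    a = a' /\ b = b'.
  move=> Aa Ab Aa' Ab' e; apply: (G3 _ _ (phi a b)); first exact: phiG.
  by rewrite e; exact: phiG.
have Anu n : A (nu n).
  by have [c hc] := A0' n; exists c; exact: G0G.
pose u := nu 0; pose v := nu 1.
have uv : u <> v by move=> /nuI.
have [[i iI]|[i iI]] := embeds_total {x | ~ A x} {x | A x}.
- pose p x := if pselect (A x) is left h then x
    else if pselect (~ A x) is left h then sval (i (exist _ x h)) else x.
  pose q x := if pselect (A x) then u else v.
  have pA x : A (p x).
    rewrite /p; case: pselect => // h; case: pselect => // h'.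
    exact: proj2_sig.
  have qA x : A (q x) by rewrite /q; case: pselect => h; exact: Anu.
  have pqI x y : p x = p y -> q x = q y -> x = y.
    rewrite /p /q; case: (pselect (A x)) => hx; case: (pselect (A y)) => hy /=.
    + by [].
    + by move=> _ e; case: (uv e).
    + by move=> _ e; case: (uv (esym e)).
    + case: pselect => // hx'; case: pselect => // hy' e _.
      suff /iI [] : i (exist _ x hx') = i (exist _ y hy') by [].
      by apply: eq_sig_hprop e => z; exact: Prop_irrelevance.
  exists (fun xy => phi (phi (p xy.1) (q xy.1)) (phi (p xy.2) (q xy.2))).
  move=> [x y] [x' y'] /= /phiI[]; rewrite ?(phiA, pA, qA) //; do ?exact: phiA.
  move=> /phiI[] // e1 e2 /phiI[] // e3 e4.
  by rewrite (pqI _ _ e1 e2) (pqI _ _ e3 e4).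
- exfalso.
  pose j a := if pselect (A a) is left h then sval (i (exist _ a h)) else a.
  have jA a : A a -> ~ A (j a).
    move=> Aa; rewrite /j; case: pselect => // h.
    exact: (proj2_sig (i (exist _ a h))).
  have jI a b : A a -> A b -> j a = j b -> a = b.
    move=> Aa Ab; rewrite /j; case: pselect => // ha; case: pselect => // hb e.
    suff /iI [] : i (exist _ a ha) = i (exist _ b hb) by [].
    by apply: eq_sig_hprop e => z; exact: Prop_irrelevance.
  pose B := j @` A.
  have BA x : B x -> ~ A x by move=> [a Aa <-]; exact: jA.
  pose C := A `|` B.
  pose p x := if pselect (exists2 a, A a & j a = x) is left h
              then projT1 (cid2 h) else x.
  pose q x := if pselect (A x) then u else v.
  have pA x : C x -> A (p x).
    rewrite /p; case: pselect => [h _|h []//].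
    by case: (cid2 h).
  have qA x : A (q x) by rewrite /q; case: pselect => h; exact: Anu.
  have pqI x y : C x -> C y -> p x = p y -> q x = q y -> x = y.
    rewrite /p /q => Cx Cy.
    case: (pselect (exists2 a, A a & j a = x)) => hx;
      case: (pselect (exists2 a, A a & j a = y)) => hy /=.
    + by case: cid2 => a /= _ <-; case: cid2 => b /= _ <- ->.
    + have Ay : A y by case: Cy => // -[b Ab e]; case: hy; exists b.
      have /BA nx : B x by [].
      by do 2 (case: pselect => // ?); move=> _ e; case: (uv (esym e)).
    + have Ax : A x by case: Cx => // -[b Ab e]; case: hx; exists b.
      have /BA nx : B y by [].
      by do 2 (case: pselect => // ?); move=> _ e; case: (uv e).
    + by [].
  pose psi x y := if pselect (A x /\ A y) then phi x y
                  else j (phi (phi (p x) (p y)) (phi (q x) (q y))).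
  have codeA x y : C x -> C y -> A (phi (phi (p x) (p y)) (phi (q x) (q y))).
    move=> Cx Cy.
    exact: (phiA _ _ (phiA _ _ (pA _ Cx) (pA _ Cy)) (phiA _ _ (qA _) (qA _))).
  pose G' := [set z | [/\ C z.1.1, C z.1.2 & z.2 = psi z.1.1 z.1.2]].
  have psiC x y : C x -> C y -> C (psi x y).
    move=> Cx Cy; rewrite /psi; case: pselect => [[Ax Ay]|nA] /=.
      by left; exact: phiA.
    by right; exists (phi (phi (p x) (p y)) (phi (q x) (q y))) => //; exact: codeA.
  have AG' x : (exists c, G' (x, x, c)) <-> C x.
    by split=> [[c []]//|Cx]; exists (psi x x).
  have GG' : G `<=` G'.
    move=> [[a b] c] abc; have [Aa Ab Ac] := G1 _ _ _ abc.
    split; rewrite /=; [by left|by left|].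
    rewrite /psi; case: pselect => [AA|[]//] /=.
    by apply: G4 abc _; exact: phiG.
  apply: (Gmax G'); first split=> //.
    have Cj : C (j u) by right; exists u => //; exact: Anu.
    move=> /(_ (j u, j u, psi (j u) (j u))) h.
    apply: (jA u (Anu 0)).
    by have [] := G1 _ _ _ (h _).
  right; split; first exact: subset_trans G0G GG'.
  split.
  - by move=> a b c [/= Ca Cb ->]; split; apply/AG' => //; exact: psiC.
  - by move=> a b /AG' Ca /AG' Cb; exists (psi a b).
  - move=> a b c a' b' [/= Ca Cb ->] [/= Ca' Cb'].
    rewrite /psi; case: pselect => [[Aa Ab]|h]; case: pselect => [[Aa' Ab']|h'] /=.
    + exact: phiI.
    + move=> e; exfalso; apply: (jA _ (codeA _ _ Ca' Cb')).
      by rewrite -e; exact: phiA.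
    + move=> e; exfalso; apply: (jA _ (codeA _ _ Ca Cb)).
      by rewrite e; exact: phiA.
    + move=> /jI e.
      have {e} := e (codeA _ _ Ca Cb) (codeA _ _ Ca' Cb').
      case/(phiI _ _ _ _ (phiA _ _ (pA _ Ca) (pA _ Cb)) (phiA _ _ (qA _) (qA _))
        (phiA _ _ (pA _ Ca') (pA _ Cb')) (phiA _ _ (qA _) (qA _))).
      case/(phiI _ _ _ _ (pA _ Ca) (pA _ Cb) (pA _ Ca') (pA _ Cb')) => e1 e2.
      case/(phiI _ _ _ _ (qA _) (qA _) (qA _) (qA _)) => e3 e4.
      by split; apply: pqI.
  - by move=> a b c c' [/= _ _ ->] [/= _ _ ->].
Qed.

(** Iterated pairing codes the entries; the length is stored too, as the code alone does not show
    where the sequence ends. *)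
Lemma embeds_seq_self T : embeds nat T -> embeds (seq T) T.
Proof.
move=> natT; have [pi piI] := embeds_square _ natT; have [nu nuI] := natT.
pose code := foldr (fun x c => pi (x, c)) (nu 0).
exists (fun s => pi (nu (size s), code s)) => s t /piI [/nuI].
elim: s t => [|x s IH] [|y t] //= [st] /piI [-> e].
by rewrite (IH _ st e).
Qed.

(** * Measurable cardinals and sums of ultrafilters *)

Lemma not_embeds_set K : ~ embeds (set K) K.
Proof.
move=> [e eI]; pose D := [set k | exists X, e X = k /\ ~ X k].
have nD : ~ D (e D) by move=> h; case: (h) => X [/eI XD]; rewrite XD.
by apply: (nD); exists D.
Qed.

Lemma card_lt_embeds {T U} :
  card_lt [set: T] [set: U] <-> embeds T U /\ ~ embeds U T.
Proof. by rewrite /card_lt !card_leT_embeds. Qed.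

(** The successor is a smallest one among the subsets of [set K] that do not embed into [K]. Any [N]
    above [K] either embeds into [set K], where its image is a competitor, or contains a copy of
    [set K]. *)
Lemma card_succ_exists K : exists Kp, card_succ K Kp.
Proof.
have nset : ~ embeds {x : set K | [set: set K] x} K.
  move=> h; apply: (@not_embeds_set K); apply: embeds_trans h.
  by exists (fun x => exist _ x I) => x y [].
pose big (B : set (set K)) := ~ embeds {x | B x} K.
have [[B nB] Bmin] :=
  @embeds_min {B | big B} (fun B => {x | sval B x}) (exist big _ nset).
rewrite /= in Bmin; exists {x | B x}; split.
  by apply/card_lt_embeds; split=> //; case: (embeds_total K {x | B x}).
move=> N /card_lt_embeds [KN nNK]; apply/card_leT_embeds.
have [[f fI]|sN] := embeds_total N (set K); last first.
  exact: embeds_trans (embeds_sig _) sN.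
have rN : embeds {x | range f x} N.
  exists (fun x => s2val (@cid2 N setT (fun a => f a = sval x) (proj2_sig x))).
  move=> [x hx] [y hy] /=; case: cid2 => a _ /= ea; case: cid2 => b _ /= eb ab.
  by apply: eq_exist; rewrite -ea -eb ab.
have nR : ~ embeds {x | range f x} K.
  move=> h; apply: nNK; apply: embeds_trans h.
  by exists (fun a => exist _ (f a) (imageT f a)) => a b [/fI].
exact: embeds_trans (Bmin (exist big _ nR)) rN.
Qed.

Section Measure.
Context {K : Type} {E : set_system K} {EU : UltraFilter E}.
Hypothesis Enp : forall x, ~ E [set x].
Hypothesis Ec : card_complete E.

(** Passes from index sets inside [K] to arbitrary index types of smaller cardinality. *)
Lemma card_complete_bigcap {J} (F : J -> set K) :
  embeds J K -> ~ embeds K J -> (forall j, E (F j)) ->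
  E [set k | forall j, F j k].
Proof.
move=> JK nKJ EF; have [[j0]|nJ] := pselect (inhabited J); last first.
  by apply: filterS filterT => k _ j; case: nJ.
have [f [g fK]] := embeds_cancel j0 JK.
have rJ : embeds {x | range f x} J.
  exists (fun x => g (sval x)) => -[x hx] [y hy] /= e; apply: eq_exist.
  by case: hx e => a _ <-; case: hy => b _ <-; rewrite !fK => ->.
have KT : embeds K {x | [set: K] x} by exists (fun x => exist _ x I) => x y [].
have lt : card_lt (range f) [set: K].
  split; first exact: card_leT.
  by move=> /card_le_embeds/(embeds_trans _ KT)/embeds_trans-/(_ _ rJ).
have rF i : range f i -> E (F (g i)) by move=> _; exact: EF.
apply: filterS (Ec _ _ lt rF) => k hk j.
by have := hk (f j) (imageT f j); rewrite /= fK.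
Qed.

(** The points not above [k] are [k] and its fewer than kappa predecessors, each of them null for
    [E]. *)
Lemma measure_final lt k : @initial_order K lt -> E [set i | lt k i].
Proof.
move=> [_ ltT lti].
have En x : E (~` [set x]) by case: (in_ultra_setVsetC [set x] EU) => // /Enp.
have : E [set i | forall j : {y | lt y k}, (~` [set sval j]) i].
  apply: card_complete_bigcap => //.
  exact: embeds_sig.
move=> h; apply: filterS (filterI h (En k)) => i [/= hi ik].
case: (ltT i k) => // ltik.
by case: (hi (exist _ i ltik)).
Qed.

(** [h i] avoids the values [H k i] for [k] before [i], which are too few to exhaust [K]; and
    [E]-almost all [i] come after a given [k]. *)
Lemma ultra_diagonal (H : K -> K -> K) :
  exists h, forall k, E [set i | h i <> H k i].
Proof.
have [lt lti] := initial_order_exists K.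
have hv i : {v | forall k, lt k i -> v <> H k i}.
  apply/cid; apply: contrapT => /forallNP hv; case: lti => _ _ /(_ i); apply.
  apply: (@embeds_surj _ _ (fun y : {y | lt y i} => H (sval y) i)) => v.
  apply: contrapT => /forallNP nv; apply: (hv v) => k ki e.
  exact: (nv (exist _ k ki)).
exists (fun i => sval (hv i)) => k.
apply: filterS (measure_final lt k lti) => i ki.
exact: (proj2_sig (hv i)) k ki.
Qed.

(** At each stage of a recursion of length kappa^+, the at most kappa earlier functions are listed
    along [K] and diagonalized. *)
Lemma ultra_distinct_family Kp : card_succ K Kp ->
  exists h : Kp -> K -> K, forall a b, a <> b -> E [set i | h a i <> h b i].
Proof.
move=> [/card_lt_embeds[KKp nKpK] Kpmin].
have [lt [ltW ltT lti]] := initial_order_exists Kp.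
pose P a (prev : forall b, lt b a -> K -> K) v :=
  forall b (ba : lt b a), E [set i | v i <> prev b ba i].
have [a prev|h Ph] := well_founded_choice P ltW.
  have segK : embeds {b | lt b a} K.
    apply: contrapT => h; apply: (lti a); apply/card_leT_embeds; apply: Kpmin.
    apply/card_lt_embeds; split=> //.
    by case: (embeds_total K {b | lt b a}).
  have [[b0]|nJ] := pselect (inhabited {b | lt b a}); last first.
    by exists id => b ba; case: nJ; constructor; exists b.
  have [f [g fK]] := embeds_cancel b0 segK.
  have [h hH] := ultra_diagonal (fun k => prev (sval (g k)) (proj2_sig (g k))).
  exists h => b ba; have := hH (f (exist _ b ba)); rewrite fK; exact.
exists h => a b ab; case: (ltT a b) => [lab|//|lba]; last exact: Ph.
by apply: filterS (Ph _ _ lab) => i /= h1 h2; apply: h1; rewrite h2.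
Qed.

End Measure.

(** * Fubini products of ultrafilters, carried along an injection *)

Definition ultra_sum {I T L} (E : set_system I) (U : set_system T)
    (iota : I * T -> L) : set_system L :=
  [set A | E [set i | U [set t | A (iota (i, t))]]].

Section UltraSum.
Context {I T L : Type} (E : set_system I) (U : set_system T).
Context {EU : UltraFilter E} {UU : UltraFilter U}.
Variable iota : I * T -> L.
Hypothesis iotaI : injective iota.

Lemma ultra_sum_ultra : UltraFilter (ultra_sum E U iota).
Proof.
have FD : Filter (ultra_sum E U iota).
  split.
  - by apply: (@filterS _ E _ _ _ _ filterT) => i _; exact: filterT.
  - move=> A B hA hB; apply: (@filterS _ E _ _ _ _ (@filterI _ E _ _ _ hA hB)).
    by move=> i [] /filterI; exact.
  - move=> A B AB hA; apply: (@filterS _ E _ _ _ _ hA) => i Ui.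
    by apply: filterS Ui => t /AB.
have PD : ProperFilter (ultra_sum E U iota).
  split; last exact: FD.
  move=> h; have [i /filter_ex [t []]] := @filter_ex _ E _ _ h.
split=> // G PG DG; apply/seteqP; split=> // A GA; apply: contrapT => nA.
suff /DG GnA : ultra_sum E U iota (~` A).
  by have [x []] := filter_ex (filterI GA GnA).
have [//|] := in_ultra_setVsetC [set i | U [set t | A (iota (i, t))]] EU.
move=> nUA; apply: (@filterS _ E _ _ _ _ nUA) => i /= nU.
by have [] := in_ultra_setVsetC [set t | A (iota (i, t))] UU.
Qed.

End UltraSum.

Section Goodness.
Context {K L Kp : Type} (E : set_system K) (U : set_system L).
Context {EU : UltraFilter E} {UU : UltraFilter U}.
Variable iota : K * L -> L.
Hypothesis iotaI : injective iota.

Lemma ultra_sum_not_good (h : Kp -> K -> K) :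
  (forall a b, a <> b -> E [set i | h a i <> h b i]) ->
  ~ embeds Kp (K * K) -> ~ succ_good Kp (ultra_sum E U iota).
Proof.
move=> hE nKp good; set D := ultra_sum E U iota in good *.
(* At points outside the range of [iota] the condition is vacuous. *)
pose Z (u : set Kp) := [set l | forall a b, u a -> u b -> a <> b ->
  forall x, iota x = l -> h a x.1 <> h b x.1].
have FD : UltraFilter D by exact: ultra_sum_ultra.
(* Z u is in D for every finite u, but only the case of pairs is needed *)
have [|g [gD gf gM]] := good (fun u => if pselect (D (Z u)) then Z u else setT).
  by move=> u _; case: pselect => // nDZ; exact: filterT.
have hi a : exists i, U [set t | g [set a] (iota (i, t))].
  exact: (@filter_ex _ E _ _ (gD [set a] (finite_set1 a))).
apply: nKp; exists (fun a => (sval (cid (hi a)), h a (sval (cid (hi a))))) => a b.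
case: (cid (hi a)) => i /= Ui; case: (cid (hi b)) => j /= Uj [ij].
move: Uj; rewrite -{j}ij => Uj e; apply: contrapT => ab.
have DZ : D (Z ([set a] `|` [set b])).
  apply: (@filterS _ E _ _ _ _ (hE a b ab)) => k hk.
  apply: (@filterS _ U _ _ _ _ filterT) => t _ a' b'.
  move=> [->|->] [->|->] // _ x /iotaI -> //=.
  exact: nesym.
have [t [ga gb]] := filter_ex (filterI Ui Uj).
have : (g [set a] `&` g [set b]) (iota (i, t)) by [].
rewrite gM; do ?exact: finite_set1.
have ab_fin : finite_set ([set a] `|` [set b]).
  by rewrite finite_setU; split; exact: finite_set1.
move=> /(gf _ ab_fin); case: pselect => //= DZ' Zt.
by apply: (Zt a b (or_introl erefl) (or_intror erefl) ab _ erefl).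
Qed.

(** The regular family of [U] is pulled back along the second coordinate; points outside the range
    of [iota] are put into no set. *)
Lemma ultra_sum_regular : regular_filter U -> regular_filter (ultra_sum E U iota).
Proof.
move=> [X [UX Xfin]]; exists (fun a => [set l | exists2 x, iota x = l & X a x.2]).
split=> [a|l].
  apply: (@filterS _ E _ _ _ _ filterT) => i _; apply: filterS (UX a) => t Xt.
  by exists (i, t).
have [[x <-]|nl] := pselect (exists x, iota x = l).
  by apply: sub_finite_set (Xfin x.2) => a [y /iotaI ->].
apply: (sub_finite_set _ (@finite_set0 L)) => a [x xl _].
by apply: nl; exists x.
Qed.

Lemma ultra_sum_flexible :
  (forall P : nat -> set K, (forall n, E (P n)) -> E [set i | forall n, P n i]) ->
  flexible U -> flexible (ultra_sum E U iota).
Proof.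
move=> Ec Ufl f fD.
pose W i := forall n, U [set t | (n < f (iota (i, t)))%N].
have EW : E W by apply: Ec => n; exact: fD.
have hX i : exists X : L -> set L, W i ->
    (forall a, U (X a)) /\ (forall t, [set a | X a t] #<= `I_(f (iota (i, t)))).
  have [Wi|nW] := pselect (W i); last by exists (fun _ => setT).
  by have [X ?] := Ufl (fun t => f (iota (i, t))) Wi; exists X.
pose X i := sval (cid (hX i)).
have XP i : W i -> (forall a, U (X i a)) /\
    (forall t, [set a | X i a t] #<= `I_(f (iota (i, t)))).
  exact: (svalP (cid (hX i))).
(* Fibres outside [W] are left empty, as the bound by [f] is known only over [W]. *)
exists (fun a => [set l | exists x, [/\ iota x = l, W x.1 & X x.1 a x.2]]).
split=> [a|l].
  apply: (@filterS _ E _ _ _ _ EW) => i Wi; have [UX _] := XP i Wi.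
  by apply: filterS (UX a) => t Xt; exists (i, t).
have [[x [<- Wx]]|nl] := pselect (exists x, iota x = l /\ W x.1).
  have [_ /(_ x.2)] := XP _ Wx; rewrite -surjective_pairing.
  by apply: card_le_trans; apply: subset_card_le => a [y [/iotaI ->]].
rewrite (_ : mkset _ = set0) ?card_ge0 //.
apply/seteqP; split=> // a [x [xl Wx _]]; apply: nl; by exists x.
Qed.

End Goodness.

(** * Regular flexible ultrafilters *)

Section RegularFlexible.
Context {L : eqType}.
Hypothesis natL : embeds nat L.

(** One point of disagreement is collected for each pair of functions from [J]. *)
Lemma separating_points (J : seq (L -> nat)) :
  exists s : seq L, forall f g, f \in J -> g \in J -> map f s = map g s -> f = g.
Proof.
have [nu _] := natL.
pose d (f g : L -> nat) := if pselect (exists t, f t <> g t) is left h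
                           then projT1 (cid h) else nu 0.
exists [seq d f g | f <- J, g <- J] => f g fJ gJ /eq_in_map fg.
apply: contrapT => nfg; have : f (d f g) = g (d f g).
  by apply: fg; exact: allpairs_f.
rewrite /d; case: pselect => [h|[]]; first by case: cid.
by apply: contrapT => /forallNP h; apply: nfg; apply/funext => t; apply: contrapT.
Qed.

(* Engelking-Karlowicz: a point of L codes a finite set s of arguments together
   with a finite table r; G f looks up the restriction of f to s in r. *)
Lemma independent_family :
  exists (G : (L -> nat) -> L -> seq L) (X : L -> set L),
    (forall t, finite_set [set a | X a t]) /\
    forall (u : seq L) (J : seq (L -> nat)) (y : (L -> nat) -> seq L),
      exists t, {in u, forall a, X a t} /\ {in J, forall f, G f t = y f}.
Proof.
pose Q : Type := seq L * seq (seq nat * seq L).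
have seqL := embeds_seq_self _ natL.
have QL : embeds Q L.
  have LL := embeds_square _ natL.
  apply: (embeds_trans _ (embeds_prod seqL _) LL).
  apply: (embeds_trans _ (embeds_seq _) seqL).
  have keyL := embeds_trans _ (embeds_seq natL) seqL.
  exact: (embeds_trans _ (embeds_prod keyL seqL) LL).
have [enc [dec encK]] := embeds_cancel ([::], [::]) QL.
exists (fun f t => nth [::] (map snd (dec t).2)
  (index (map f (dec t).1) (map fst (dec t).2))).
exists (fun a t => a \in (dec t).1); split=> [t|u J y].
  exact: finite_seq.
have [s sJ] := separating_points J.
(* Separation by [s] makes the keys of the table distinct, so that the lookup for [f] finds [y f];
   appending [u] puts the point into [X a] for each [a] in [u]. *)
exists (enc (s ++ u, [seq (map f (s ++ u), y f) | f <- J])); rewrite encK /=.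
split=> [a au|f fJ]; first by rewrite mem_cat au orbT.
rewrite -!map_comp /comp /=.
have keyI : {in J &, injective (fun f => map f (s ++ u))}.
  move=> g h gJ hJ; rewrite !map_cat => /eqP.
  by rewrite eqseq_cat ?size_map // => /andP[/eqP e _]; exact: sJ e.
rewrite (nth_map f) ?nth_index_map //.
by rewrite -(size_map (fun f => map f (s ++ u))) index_mem; exact: map_f.
Qed.

(** Otherwise [L -> nat] would embed into the product of the segment below [f] with [nat]. This
    contradicts initiality of the order if the segment is infinite, and Cantor's theorem if it
    embeds into [nat]. *)
Lemma fresh_function (lt : (L -> nat) -> (L -> nat) -> Prop) f
    (s : forall g, lt g f -> seq (L -> nat)) :
  initial_order lt -> exists c, forall g (gf : lt g f), c \notin s g gf.
Proof.
move=> [_ _ lti]; apply: contrapT => /forallNP nc.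
have IS : embeds (L -> nat) ({g | lt g f} * nat).
  apply: (@embeds_surj _ _
    (fun x => nth f (s (sval x.1) (proj2_sig x.1)) x.2)) => c.
  apply: contrapT => /forallNP h; apply: (nc c) => g gf; apply/negP => cs.
  apply: (h (exist _ g gf, index c (s g gf))); exact: nth_index.
have [nS|Sn] := embeds_total nat {g | lt g f}.
  apply: (lti f); apply: embeds_trans IS _.
  apply: embeds_trans _ (embeds_square _ nS).
  by apply: embeds_prod => //; exists id.
apply: (@not_embeds_set L).
have SI : embeds (set L) (L -> nat).
  exists (fun A t => nat_of_bool `[< A t >]) => A B AB; apply/seteqP.
  by split=> t; have := congr1 (@^~ t) AB; do 2 case: asboolP.
apply: embeds_trans SI _; apply: embeds_trans IS _.
apply: embeds_trans (embeds_prod Sn (ex_intro _ id (fun _ _ => id))) _.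
by apply: embeds_trans natL; apply: embeds_square; exists id.
Qed.

Section Independence.
Variable G : (L -> nat) -> L -> seq L.

(* S is the set of indices already used up *)
Definition independent (D : set_system L) (S : set (L -> nat)) :=
  forall A (J : seq (L -> nat)) (y : (L -> nat) -> seq L), D A ->
    {in J, forall f, ~ S f} -> exists t, A t /\ {in J, forall f, G f t = y f}.

(* no ultrafilter extending D violates flexibility at f *)
Definition settles (D : set_system L) (f : L -> nat) :=
  (exists n, D [set t | (f t <= n)%N]) \/
  exists X : L -> set L,
    (forall a, D (X a)) /\ (forall t, [set a | X a t] #<= `I_(f t)).

Lemma card_le_seq (s : seq L) n : (size s <= n)%N -> [set a | a \in s] #<= `I_n.
Proof.
move=> sn; apply/card_le_embeds.
have h (x : {a | a \in s}) : (index (sval x) s < n)%N.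
  by apply: leq_trans sn; rewrite index_mem; exact: (proj2_sig x).
exists (fun x : {a | a \in s} => exist `I_n (index (sval x) s) (h x)).
move=> [x xs] [y ys] [] /= xy; apply: eq_exist.
by rewrite -(nth_index x xs) -[RHS](nth_index x ys) xy.
Qed.

(* The dichotomy is whether some finite condition, G g t = y g for g in J,
   forces f <= n.
   If none does, then any condition has an extension that forces n < f modulo
   D, so all the sets {n < f} can be added without using up any index. *)
Lemma settle_step D S f c : Filter D -> independent D S -> ~ S c ->
  exists D' (s : seq (L -> nat)), [/\ Filter D', D `<=` D',
    independent D' (S `|` [set g | g \in s]) & settles D' f].
Proof.
move=> FD indD Sc.
have [[n [J [y [JS force]]]]|nforce] := pselect (exists n (J : seq (L -> nat)) y,
  {in J, forall g, ~ S g} /\ forall J' y', {in J', forall g, ~ S g} ->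
    {in J, forall g, y' g = y g} -> forall A, D A -> exists t,
      [/\ A t, (f t <= n)%N & {in J ++ J', forall g, G g t = y' g}]).
  (* The new filter adds to [D] the set where [f t <= n] and the forcing condition holds; the
     indices in [J] are thereby used up. *)
  exists [set X | exists2 A, D A & forall t, A t -> (f t <= n)%N ->
    {in J, forall g, G g t = y g} -> X t], J; split.
  - split; first by exists setT => //; exact: filterT.
    + move=> X Y [A DA AX] [B DB BY]; exists (A `&` B); first exact: filterI.
      by move=> t [At Bt] ft Gt; split; [exact: AX|exact: BY].
    + by move=> X Y XY [A DA AX]; exists A => // t At ft Gt; exact/XY/AX.
  - by move=> A DA; exists A.
  - move=> X J' y' [A DA AX] J'S.
    (* [z] extends the forcing condition and agrees with [y'] on [J'], which is disjoint from
       [J]. *)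
    pose z g := if g \in J then y g else y' g.
    have [||t [At ft Gt]] := force J' z _ _ A DA.
    + by move=> g gJ' Sg; apply: (J'S g gJ'); left.
    + by rewrite /z => g ->.
    exists t; split=> [|g gJ'].
      by apply: AX => // g gJ; rewrite Gt ?mem_cat /z gJ.
    rewrite Gt ?mem_cat ?gJ' ?orbT // /z; case: ifP => // gJ.
    by case: (J'S g gJ'); right.
  - by left; exists n; exists setT => //; exact: filterT.
pose Y a := [set t | a \in G c t /\ (size (G c t) <= f t)%N].
pose D' := [set X | exists A n (u : seq L), D A /\
  forall t, A t -> (n < f t)%N -> {in u, forall a, Y a t} -> X t].
exists D', [:: c]; split.
- split.
  + by exists setT, 0, [::]; split=> //; exact: filterT.
  + move=> X X' [A [n [u [DA AX]]]] [A' [n' [u' [DA' AX']]]].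
    exists (A `&` A'), (maxn n n'), (u ++ u'); split; first exact: filterI.
    move=> t [At At']; rewrite gtn_max => /andP[nt nt'] Yt; split.
      by apply: AX => // a au; apply: Yt; rewrite mem_cat au.
    by apply: AX' => // a au; apply: Yt; rewrite mem_cat au orbT.
  + move=> X X' XX' [A [n [u [DA AX]]]]; exists A, n, u; split=> // t At nt Yt.
    exact/XX'/AX.
- by move=> A DA; exists A, 0, [::].
- move=> X J y [A [n [u [DA AX]]]] JS.
  have cJ : c \notin J.
    by apply/negP => cJ; case: (JS c cJ); right; exact: mem_head.
  pose y1 g := if g == c then u else y g.
  have J1S : {in c :: J, forall g, ~ S g}.
    move=> g; rewrite inE => /orP[/eqP ->//|gJ] Sg.
    by case: (JS g gJ); left.
  (* Prescribing [u] as the value at [c] does not force [f] below [maxn n (size u)]. Some extension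
     thus makes [f] exceed both numbers modulo [D], so that [u] respects the size bound in [Y]. *)
  have [J' [y' [A' [J'S yy' DA' hA']]]] : exists J' y' A', [/\
      {in J', forall g, ~ S g}, {in c :: J, forall g, y' g = y1 g}, D A' &
      forall t, A' t -> {in (c :: J) ++ J', forall g, G g t = y' g} ->
        (maxn n (size u) < f t)%N].
    apply: contrapT => h; apply: nforce.
    exists (maxn n (size u)), (c :: J), y1; split=> // J' y' J'S yy' A' DA'.
    apply: contrapT => h'; apply: h; exists J', y', A'; split=> // t A't Gt.
    by rewrite ltnNge; apply/negP => ft; apply: h'; exists t.
  have [|t [[At A't] Gt]] := indD (A `&` A') ((c :: J) ++ J') y' (filterI DA DA').
    by move=> g; rewrite mem_cat => /orP[/J1S|/J'S].
  have := hA' t A't Gt; rewrite gtn_max => /andP[nt ut].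
  exists t; split=> [|g gJ].
    have Gc : G c t = u by rewrite Gt ?yy' /y1 ?eqxx ?mem_head.
    by apply: AX => // a au; split; rewrite Gc // ltnW.
  have gcJ : g \in c :: J by rewrite inE gJ orbT.
  rewrite Gt; last by rewrite mem_cat gcJ.
  by rewrite yy' // /y1; case: eqP => // gc; rewrite -gc gJ in cJ.
- right; exists Y; split=> [a|t].
    exists setT, 0, [:: a]; split; first exact: filterT.
    by move=> t _ _; apply; exact: mem_head.
  have [st|st] := leqP (size (G c t)) (f t).
    by apply: card_le_trans (card_le_seq _ _ st); apply: subset_card_le => a [].
  rewrite (_ : mkset _ = set0) ?card_ge0 //.
  by apply/seteqP; split=> // a [_]; rewrite leqNgt st.
Qed.

End Independence.

Lemma regular_flexible_ultrafilter :
  exists U : set_system L, [/\ UltraFilter U, regular_filter U & flexible U].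
Proof.
have [G [X [Xfin GX]]] := independent_family.
have [lt ltP] := initial_order_exists (L -> nat).
have [ltW ltT _] := ltP.
(* Transitivity is derived from trichotomy, as well-foundedness excludes cycles. *)
have lt3 x y z : lt x y -> lt y z -> lt z x -> False.
  elim/(well_founded_ind ltW): x y z => x IH y z xy yz zx.
  exact: (IH z zx x y zx xy yz).
have lt_trans x y z : lt x y -> lt y z -> lt x z.
  move=> xy yz; case: (ltT x z) => // [xz|zx]; last by case: (lt3 _ _ _ xy yz zx).
  rewrite xz in xy *; elim/(well_founded_ind ltW): y z xy yz {xz} => y IH z zy yz.
  by exfalso; move: (IH _ zy _ yz zy) => zz; case: (lt3 _ _ _ zz zz zz).
pose D0 : set_system L :=
  [set A | exists u : seq L, forall t, {in u, forall a, X a t} -> A t].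
pose St : Type := set_system L * seq (L -> nat).
(* For [Q] an initial segment this is the union of the stages reached so far; for [Q] always true it
   is the final filter. [D0] makes every stage contain the regular family. *)
pose Dof (Q : (L -> nat) -> Prop) (s : forall g, Q g -> St) : set_system L :=
  [set A | D0 A \/ exists g (gQ : Q g), (s g gQ).1 A].
pose Sof (Q : (L -> nat) -> Prop) (s : forall g, Q g -> St) : set (L -> nat) :=
  [set h | exists g (gQ : Q g), h \in (s g gQ).2].
(* The premises hold only for histories built by the recursion itself; [allgood] discharges them by
   induction. *)
pose P f (s : forall g, lt g f -> St) (v : St) :=
  Filter (Dof _ s) -> independent G (Dof _ s) (Sof _ s) ->
  [/\ Filter v.1, Dof _ s `<=` v.1,
    independent G v.1 (Sof _ s `|` [set g | g \in v.2]) & settles v.1 f].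
have [f s|st stP] := well_founded_choice P ltW.
  have [[FD ID]|h] :=
    pselect (Filter (Dof _ s) /\ independent G (Dof _ s) (Sof _ s)); last by exists (set0, [::]) => FD ID; case: h.
  have [c cS] := fresh_function lt f (fun g gf => (s g gf).2) ltP.
  have [|D' [s' hD']] := settle_step G _ _ f c FD ID.
    by move=> [g [gf cg]]; move: (cS g gf); rewrite cg.
  by exists (D', s').
pose D Q := Dof Q (fun g _ => st g).
pose S Q := Sof Q (fun g _ => st g).
pose good f := [/\ Filter (st f).1, D (lt^~ f) `<=` (st f).1,
  independent G (st f).1 (S (lt^~ f) `|` [set g | g \in (st f).2])
  & settles (st f).1 f].
have D0_filter : Filter D0.
  split; first by exists [::].
  - move=> A B [u uA] [v vB]; exists (u ++ v) => t Xt; split.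
      by apply: uA => a au; apply: Xt; rewrite mem_cat au.
    by apply: vB => a av; apply: Xt; rewrite mem_cat av orbT.
  - by move=> A B AB [u uA]; exists u => t /uA /AB.
have D_filter Q : (forall g, Q g -> good g) -> Filter (D Q).
  move=> Qgood; split.
  - by left; exact: filterT.
  - move=> A B [A0|[g [Qg Ag]]] [B0|[h [Qh Bh]]].
    + by left; exact: filterI.
    + right; exists h, Qh; have [F sub _ _] := Qgood h Qh.
      by apply: filterI => //; apply: sub; left.
    + right; exists g, Qg; have [F sub _ _] := Qgood g Qg.
      by apply: filterI => //; apply: sub; left.
    + have [Fg subg _ _] := Qgood g Qg; have [Fh subh _ _] := Qgood h Qh.
      case: (ltT g h) => [gh|gh|hg].
      * right; exists h, Qh; apply: filterI => //.
        by apply: subh; right; exists g, gh.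
      * by right; exists h, Qh; apply: filterI => //; rewrite -gh.
      * right; exists g, Qg; apply: filterI => //.
        by apply: subg; right; exists h, hg.
  - move=> A B AB [A0|[g [Qg Ag]]]; first by left; exact: filterS A0.
    by right; exists g, Qg; have [F _ _ _] := Qgood g Qg; exact: filterS Ag.
have allgood f : good f.
  elim/(well_founded_ind ltW): f => f IH.
  apply: (stP f); first exact: (D_filter (lt^~ f)).
  (* Each set of the union lies in [D0] or in a single stage [g], and the indices used up by stage
     [g] are among those excluded here. *)
  move=> A J y [[u uA] _|[g [gf Ag]] JS].
    have [t [Xt Gt]] := GX u J y; exists t; split=> //; exact: uA.
  have [_ _ ind _] := IH g gf; apply: ind => // h hJ Sh; apply: (JS h hJ).
  case: Sh => [[k [kg hk]]|hg]; last by exists g, gf.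
  by exists k, (lt_trans _ _ _ kg gf).
have DT_filter : Filter (D (fun=> True)) by apply: D_filter => g _.
have DT_proper : ProperFilter (D (fun=> True)).
  apply: Build_ProperFilter_ex => A [[u uA]|[g [_ Ag]]].
    by have [t [Xt _]] := GX u [::] (fun=> [::]); exists t; exact: uA.
  have [_ _ ind _] := allgood g.
  by have [|t [At _]] := ind A [::] (fun=> [::]) Ag; [|exists t].
have [U [UU DU]] := ultraFilterLemma DT_proper.
have stU f : (st f).1 `<=` U by move=> A Af; apply: DU; right; exists f, I.
exists U; split=> //.
- exists X; split=> // a; apply: DU; left.
  by exists [:: a] => t; apply; exact: mem_head.
- move=> f fU; have [_ _ _ [[n fn]|[Y [DY Yf]]]] := allgood f.
    have [t [nt]] := filter_ex (filterI (fU n) (stU f _ fn)).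
    by rewrite /= leqNgt nt.
  by exists Y; split=> // a; apply: (stU f).
Qed.

End RegularFlexible.

Theorem theorem7p11 (K L : Type)
    (hK : measurable_cardinal K) (hKL : card_lt [set: K] [set: L]) :
  exists D : set_system L,
    [/\ UltraFilter D /\ regular_filter D,
        flexible D
      & exists Kp : Type, card_succ K Kp /\ ~ succ_good Kp D].
Proof.
have [/card_lt_embeds[natK nKnat] [E [EU Enp Ec]]] := hK.
have [KL _] := (card_lt_embeds.1 hKL).
have natL := embeds_trans _ natK KL.
have [U [UU Ureg Uflex]] := @regular_flexible_ultrafilter {classic L} natL.
have [iota iotaI] : embeds (K * L) L.
  apply: (embeds_trans _ _ (embeds_square _ natL)).
  by apply: embeds_prod => //; exists id.
exists (ultra_sum E U iota); split.
- by split; [exact: ultra_sum_ultra|exact: ultra_sum_regular].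
- apply: ultra_sum_flexible => // P EP.
  (* Completeness covers countable intersections because [K] is uncountable. *)
  exact: card_complete_bigcap.
have [Kp KpP] := card_succ_exists K; exists Kp; split=> //.
have [h hE] := ultra_distinct_family Enp Ec Kp KpP.
apply: ultra_sum_not_good hE _ => // KpKK.
have [/card_lt_embeds[_ nKpK] _] := KpP.
(* As [K * K] embeds into [K], an embedding of [Kp] into [K * K] would make [Kp] no larger than
   [K]. *)
by apply: nKpK; apply: (embeds_trans _ KpKK); exact: embeds_square.
Qed.
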